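(* Let $\kappa:\mathbb{D}\to\mathbb{R}$ be a continuous function with $\kappa(0)<0$. If $u(z)=-\log|z|-\log\log(1/|z|)+w(z)$, where $w(z)=O(1)$ for $z\to0$, is a ($C^2$-)solution to $\Delta u=-\kappa(z)\,e^{2u}$ in $\mathbb{D}\setminus\{0\}$, then $w$ is continuous at $z=0$ and $w(0)=-\log\sqrt{-\kappa(0)}$.
   Context: $\mathbb{D}=\{z\in\mathbb{C}:|z|<1\}$ and $\Delta=\partial_x^2+\partial_y^2$ for $z=x+iy$. The function $w$ is real-valued and defined on $\mathbb{D}\setminus\{0\}$; ''continuous at $z=0$'' with value $w(0)$ means that $\lim_{z\to0}w(z)$ exists and equals $w(0)$. *)

(* Defs.v *)
From Stdlib Require Export Reals.
From Coquelicot Require Export Coquelicot.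
Open Scope R_scope.

Definition unit_disk (z : C) : Prop := Cmod z < 1.

Definition punctured_disk (z : C) : Prop := unit_disk z /\ z <> RtoC 0.

Definition in_xy (u : C -> R) (x y : R) : R := u (x, y).

(* Partial derivatives at a point depend only on values near that point, so on
   an open set D the total function u is unconstrained outside D. *)
Definition C2_on (D : C -> Prop) (u : C -> R) : Prop :=
  forall z : C, D z -> ex_diff_n (in_xy u) 2 (fst z) (snd z).

Definition laplacian (u : C -> R) (z : C) : R :=
  partial_derive 2 0 (in_xy u) (fst z) (snd z)
  + partial_derive 0 2 (in_xy u) (fst z) (snd z).

Definition bigO_1_at_0 (w : C -> R) : Prop :=
  exists M : R, locally' (RtoC 0) (fun z : C => Rabs (w z) <= M).

(* The function w lives on the punctured disk: locally' excludes the (junk)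
   value of the total function w at 0, and l is the value that extends w
   continuously. *)
Definition continuous_at_0_with_value (w : C -> R) (l : R) : Prop :=
  filterlim w (locally' (RtoC 0)) (locally l).

(* Main.v *)
Require Import Defs.
From Stdlib Require Import Reals Lra List Classical ClassicalEpsilon.
From Coquelicot Require Import Coquelicot.
Open Scope R_scope.

(** Write L = ln (1/|z|) > 0, a = - kappa(0) and k = ln (sqrt a).  The function
    u0 = L - ln L is the log-density of the hyperbolic metric of the punctured
    disk: Delta u0 = exp (2 u0) = 1 / (|z|^2 L^2).  Hence v = w + k, which is
    u - u0 + k, satisfies

      |z|^2 L^2 Delta v = (- kappa(z) / a) exp (2 v) - 1,

    and - kappa(z) / a tends to 1.  So wherever s v > eta, with a sign
    s = 1 or s = - 1, the quantity |z|^2 L^2 Delta (s v) stays above a constant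
    c > 0 once z is close to 0: where s v is large it is strongly subharmonic.
    The theorem says that s v <= eta near 0 for both signs and all eta > 0.

    This follows from the maximum principle
    ([le_near_0_of_laplacian_lower_bound]).  Delta (F(L)) = F''(L) / |z|^2
    because L is harmonic with |grad L|^2 = 1 / |z|^2.  For a point z1 put
    s1 = L(z1) and compare s v with the barrier

      eta + A (ln L - ln s1)^2

    on the annulus |ln L - ln s1| <= lam, where A lam^2 = M is an a priori bound
    of s v.  On the boundary s v is below the barrier.  Inside,
    |z|^2 L^2 Delta (barrier) = 2 A (1 - (ln L - ln s1)) <= 2 A (1 + lam), which
    is less than c when lam is large, so the difference has no positive interior
    maximum.  At z1 the barrier equals eta, whence s v(z1) <= eta.  The constants
    A and lam depend on M and c only, and the annulus is inside the region of
    validity as soon as s1 is large, that is, z1 is close to 0.  The maximum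
    exists by [continuous_attains_max], and [laplacian_le_radial] is the
    second-derivative test there. *)

(** * Maxima of continuous functions on compact plane sets *)

Lemma list_argmax {T : Type} (f : T -> R) (l : list T) (d : T) :
  exists m, In m (d :: l) /\ forall t, In t (d :: l) -> f t <= f m.
Proof.
  induction l as [|a l [m [Hm Hmax]]].
  - exists d; split; [now left|].
    intros t [->|[]]; apply Rle_refl.
  - destruct (Rle_dec (f m) (f a)) as [Hle|Hgt].
    + exists a; split; [now right; left|].
      intros t [->|[->|Ht]].
      * apply Rle_trans with (f m); [apply Hmax; now left | exact Hle].
      * apply Rle_refl.
      * apply Rle_trans with (f m); [apply Hmax; now right | exact Hle].
    + exists m; split.
      * destruct Hm as [->|Hm]; [now left | now right; right].
      * intros t [->|[->|Ht]].
        -- apply Hmax; now left.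
        -- lra.
        -- apply Hmax; now right.
Qed.

(** If no point of K were a maximum, every point t of the plane would have a
    neighbourhood on which f, restricted to K, stays below its value at a
    single point of K.  Finitely many of these neighbourhoods cover K, and the
    best of the associated points lies strictly below itself. *)
Lemma continuous_attains_max (K : C -> Prop) (f : C -> R) (B : R) :
  closed K ->
  (forall z, K z -> Rabs (fst z) <= B /\ Rabs (snd z) <= B) ->
  (forall z, K z -> continuous f z) ->
  (exists z, K z) ->
  exists p, K p /\ forall z, K z -> f z <= f p.
Proof.
  intros Kclosed Kbounded fcont [z0 Kz0].
  apply NNPP; intro Hno.
  assert (Hbetter : forall p, K p -> exists q, K q /\ f p < f q).
  { intros p Kp. apply NNPP; intro Hn. apply Hno. exists p; split; [exact Kp|].
    intros z Kz. apply Rnot_lt_le; intro Hlt. apply Hn. now exists z. }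
  assert (Hloc : forall t : C, exists qd : C * posreal,
    K (fst qd) /\ forall x, K x -> ball t (snd qd) x -> f x < f (fst qd)).
  { intros t. destruct (classic (K t)) as [Kt|nKt].
    - destruct (Hbetter t Kt) as [q [Kq Hq]].
      assert (Hd : 0 < f q - f t) by lra.
      assert (Hl : locally t (fun x => ball (f t) (mkposreal _ Hd) (f x))).
      { apply (fcont t Kt). exists (mkposreal _ Hd). easy. }
      destruct Hl as [d Hball].
      exists (q, d); split; [exact Kq|].
      intros x _ Hx. specialize (Hball x Hx).
      apply Rabs_lt_between in Hball. simpl in *.
      unfold minus, plus, opp in Hball; simpl in Hball. lra.
    - assert (Hl : locally t (fun x => ~ K x)).
      { apply NNPP; intro Hn. now apply nKt, Kclosed. }
      destruct Hl as [d Hball].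
      exists (z0, d); split; [exact Kz0|].
      intros x Kx Hx. now destruct (Hball x Hx). }
  set (g := fun t : C => proj1_sig (constructive_indefinite_description _ (Hloc t))).
  assert (Hg : forall t : C, K (fst (g t)) /\
    forall x, K x -> ball t (snd (g t)) x -> f x < f (fst (g t))).
  { intro t. exact (proj2_sig (constructive_indefinite_description _ (Hloc t))). }
  set (toC := fun t : Compactness.Tn 2 R => (fst t, fst (snd t)) : C).
  apply (@compactness_list 2 (- B, (- B, tt)) (B, (B, tt))
           (fun t => snd (g (toC t)))).
  intros [l Hcover].
  destruct (list_argmax (fun t => f (fst (g (toC t)))) l (0, (0, tt)))
    as [m [_ Hm]].
  set (q := fst (g (toC m))).
  assert (Kq : K q) by apply Hg.
  destruct (Kbounded q Kq) as [Hq1 Hq2].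
  apply Rabs_le_between in Hq1. apply Rabs_le_between in Hq2.
  destruct (Hcover (fst q, (snd q, tt))) as [t [Hin [_ Hclose]]].
  { simpl; tauto. }
  assert (Hlt : f q < f (fst (g (toC t)))).
  { apply (proj2 (Hg (toC t))); [exact Kq|].
    destruct t as [t1 [t2 []]]. destruct Hclose as [H1 [H2 _]].
    split; assumption. }
  specialize (Hm t (or_intror Hin)). fold q in Hm. cbv beta in Hm. lra.
Qed.

(** * The modulus and its logarithm *)

Lemma Cmod_sqr (z : C) : Cmod z ^ 2 = fst z ^ 2 + snd z ^ 2.
Proof.
  unfold Cmod. rewrite pow2_sqrt; [easy|].
  apply Rplus_le_le_0_compat; apply pow2_ge_0.
Qed.

Lemma continuous_Cmod (z : C) : continuous Cmod z.
Proof.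
  apply (continuous_comp (fun z : C => fst z ^ 2 + snd z ^ 2) sqrt).
  - apply (continuous_plus (fun z : C => fst z ^ 2) (fun z : C => snd z ^ 2)).
    + apply (continuous_comp (fun z : C => fst z) (fun t => t ^ 2)).
      * apply continuous_fst.
      * apply (ex_derive_continuous (fun t => t ^ 2)); now auto_derive.
    + apply (continuous_comp (fun z : C => snd z) (fun t => t ^ 2)).
      * apply continuous_snd.
      * apply (ex_derive_continuous (fun t => t ^ 2)); now auto_derive.
  - apply continuity_pt_filterlim, continuity_pt_sqrt.
    apply Rplus_le_le_0_compat; apply pow2_ge_0.
Qed.

Lemma open_Cmod_between (a b : R) : open (fun z : C => a < Cmod z < b).
Proof.
  apply (open_and (fun z : C => a < Cmod z) (fun z : C => Cmod z < b)).
  - apply (open_comp Cmod (fun r => a < r)); [|apply open_gt].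
    intros z _; apply continuous_Cmod.
  - apply (open_comp Cmod (fun r => r < b)); [|apply open_lt].
    intros z _; apply continuous_Cmod.
Qed.

Lemma closed_Cmod_between (a b : R) : closed (fun z : C => a <= Cmod z <= b).
Proof.
  apply (closed_and (fun z : C => a <= Cmod z) (fun z : C => Cmod z <= b)).
  - apply (closed_comp Cmod (fun r => a <= r)); [|apply closed_ge].
    intros z; apply continuous_Cmod.
  - apply (closed_comp Cmod (fun r => r <= b)); [|apply closed_le].
    intros z; apply continuous_Cmod.
Qed.

Lemma punctured_disk_Cmod (z : C) : punctured_disk z <-> 0 < Cmod z < 1.
Proof.
  split.
  - intros [H1 H2]. split; [now apply Cmod_gt_0 | exact H1].
  - intros [H1 H2]. split; [exact H2 | now apply Cmod_gt_0].
Qed.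

Lemma locally'_Cmod (P : C -> Prop) (r : R) :
  0 < r -> (forall z, 0 < Cmod z < r -> P z) -> locally' (RtoC 0) P.
Proof.
  intros Hr HP.
  assert (H : locally (RtoC 0) (fun z => -1 < Cmod z < r)).
  { apply open_Cmod_between. rewrite Cmod_0. lra. }
  unfold locally', within. revert H. apply filter_imp. intros z Hz Hz0. apply HP.
  split; [now apply Cmod_gt_0 | apply Hz].
Qed.

Lemma locally'_Cmod_inv (P : C -> Prop) :
  locally' (RtoC 0) P ->
  exists r, 0 < r < 1 /\ forall z, 0 < Cmod z < r -> P z.
Proof.
  intros [e He]. assert (E := cond_pos e).
  exists (Rmin (e / 2) (1 / 2)). split.
  - assert (H := Rmin_r (e / 2) (1 / 2)). split; [|lra].
    apply Rmin_pos; lra.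
  - intros z Hz. assert (H := Rmin_l (e / 2) (1 / 2)). apply He.
    + assert (Hm := Rmax_Cmod z).
      assert (H1 := Rmax_l (Rabs (fst z)) (Rabs (snd z))).
      assert (H2 := Rmax_r (Rabs (fst z)) (Rabs (snd z))).
      split; unfold ball; simpl; unfold AbsRing_ball, minus, plus, opp, abs; simpl;
        rewrite Ropp_0, Rplus_0_r; lra.
    + apply Cmod_gt_0, Hz.
Qed.

Lemma is_derive_log_modulus (t y : R) :
  0 < t ^ 2 + y ^ 2 ->
  is_derive (fun t => ln (1 / sqrt (t ^ 2 + y ^ 2))) t (- t / (t ^ 2 + y ^ 2)).
Proof.
  intros H. assert (Hs := sqrt_lt_R0 _ H). auto_derive.
  - simpl in Hs. repeat split; try lra.
    apply Rdiv_lt_0_compat; lra.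
  - assert (E := sqrt_sqrt (t ^ 2 + y ^ 2) ltac:(lra)).
    replace (t ^ 2 + y ^ 2) with (sqrt (t ^ 2 + y ^ 2) * sqrt (t ^ 2 + y ^ 2)) at 1.
    simpl in *. field. lra.
Qed.

Lemma log_modulus_pos (r : R) : 0 < r < 1 -> 0 < ln (1 / r).
Proof.
  intros Hr. rewrite <- ln_1. apply ln_increasing; [lra|].
  apply Rmult_lt_reg_r with r; [lra|]. unfold Rdiv.
  rewrite Rmult_assoc, Rinv_l by lra. lra.
Qed.

Lemma exp_opp_log_modulus (r : R) : 0 < r -> exp (- ln (1 / r)) = r.
Proof.
  intros Hr. unfold Rdiv. rewrite Rmult_1_l, ln_Rinv, Ropp_involutive by exact Hr.
  now apply exp_ln.
Qed.

Lemma log_modulus_exp (t : R) : ln (1 / exp (- t)) = t.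
Proof.
  unfold Rdiv. rewrite Rmult_1_l, <- exp_Ropp, Ropp_involutive. apply ln_exp.
Qed.

Lemma log_modulus_le (r r' : R) : 0 < r <= r' -> ln (1 / r') <= ln (1 / r).
Proof.
  intros Hr. apply ln_le.
  - apply Rdiv_lt_0_compat; lra.
  - apply Rmult_le_compat_l; [lra|]. apply Rinv_le_contravar; lra.
Qed.

Lemma continuous_log_modulus (z : C) :
  punctured_disk z -> continuous (fun z => ln (1 / Cmod z)) z.
Proof.
  intros Hz. apply punctured_disk_Cmod in Hz.
  apply (continuous_comp Cmod (fun r => ln (1 / r))).
  - apply continuous_Cmod.
  - apply (ex_derive_continuous (fun r => ln (1 / r))). auto_derive.
    repeat split; [lra | apply Rdiv_lt_0_compat; lra].
Qed.

(** * Second-derivative tests *)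

(** The derivative g' is only known to be differentiable at x.  If d > 0, then
    g' exceeds g' x just to the right of x and is below it just to the left; so
    g rises to the right when g' x >= 0, and rises to the left otherwise, and
    one does not have to show that g' x = 0. *)
Lemma second_derivative_nonpos_at_local_max (g g' : R -> R) (x d : R) :
  locally x (fun t => is_derive g t (g' t)) ->
  is_derive g' x d ->
  locally x (fun t => g t <= g x) ->
  d <= 0.
Proof.
  intros [e1 Hg] Hg' [e2 Hmax].
  assert (E1 := cond_pos e1). assert (E2 := cond_pos e2).
  assert (Hball : forall (e : posreal) t, Rabs (t - x) < e -> ball x e t) by easy.
  apply Rnot_lt_le; intro Hd.
  assert (Hlim := proj1 (is_derive_Reals _ _ _) Hg').
  destruct (Hlim (d / 2)) as [e3 Hslope]; [lra|].
  assert (E3 := cond_pos e3).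
  set (h := Rmin e1 (Rmin e2 e3) / 2).
  assert (Hh : 0 < h /\ h < e1 /\ h < e2 /\ h < e3).
  { assert (H1 := Rmin_l e1 (Rmin e2 e3)). assert (H2 := Rmin_r e1 (Rmin e2 e3)).
    assert (H3 := Rmin_l e2 e3). assert (H4 := Rmin_r e2 e3).
    assert (H5 : 0 < Rmin e1 (Rmin e2 e3)) by (repeat apply Rmin_pos; assumption).
    unfold h; lra. }
  assert (Hslope' : forall k, 0 < Rabs k <= h -> (d / 2) < (g' (x + k) - g' x) / k).
  { intros k Hk. assert (k <> 0) by (intros ->; rewrite Rabs_R0 in Hk; lra).
    specialize (Hslope k H ltac:(lra)). apply Rabs_lt_between in Hslope. lra. }
  destruct (Rle_dec 0 (g' x)) as [Hpos|Hneg].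
  - destruct (MVT_cor2 g g' x (x + h)) as [c [Hc1 Hc2]]; [lra| |].
    { intros c Hc. apply is_derive_Reals, Hg, Hball, Rabs_lt_between; lra. }
    specialize (Hslope' (c - x)). rewrite Rabs_pos_eq in Hslope' by lra.
    specialize (Hslope' ltac:(lra)). replace (x + (c - x)) with c in Hslope' by ring.
    apply Rmult_lt_compat_r with (r := c - x) in Hslope'; [|lra].
    unfold Rdiv at 2 in Hslope'. rewrite Rmult_assoc, Rinv_l, Rmult_1_r in Hslope' by lra.
    assert (0 < d / 2 * (c - x)) by (apply Rmult_lt_0_compat; lra).
    assert (0 < g' c * (x + h - x)) by (apply Rmult_lt_0_compat; lra).
    assert (g (x + h) <= g x) by (apply Hmax, Hball, Rabs_lt_between; lra).
    lra.
  - destruct (MVT_cor2 g g' (x - h) x) as [c [Hc1 Hc2]]; [lra| |].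
    { intros c Hc. apply is_derive_Reals, Hg, Hball, Rabs_lt_between; lra. }
    specialize (Hslope' (c - x)). rewrite Rabs_left in Hslope' by lra.
    specialize (Hslope' ltac:(lra)). replace (x + (c - x)) with c in Hslope' by ring.
    apply Rmult_lt_compat_r with (r := x - c) in Hslope'; [|lra].
    replace ((g' c - g' x) / (c - x) * (x - c)) with (g' x - g' c) in Hslope' by (field; lra).
    assert (0 < d / 2 * (x - c)) by (apply Rmult_lt_0_compat; lra).
    assert (g' c * (x - (x - h)) < 0).
    { apply Ropp_lt_cancel. rewrite Ropp_0, Ropp_mult_distr_l.
      apply Rmult_lt_0_compat; lra. }
    assert (g (x - h) <= g x) by (apply Hmax, Hball, Rabs_lt_between; lra).
    lra.
Qed.

(** One coordinate direction of the test for s u - F(L), on a line on which the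
    other coordinate is the constant y.  The terms in F' have opposite signs in
    the two directions; this is the harmonicity of L. *)
Lemma second_derivative_le_radial (U F F' F'' : R -> R) (s x y : R) :
  (forall t, 0 < t -> is_derive F t (F' t)) ->
  (forall t, 0 < t -> is_derive F' t (F'' t)) ->
  0 < x ^ 2 + y ^ 2 < 1 ->
  locally x (fun t => ex_derive U t) ->
  ex_derive (Derive U) x ->
  locally x (fun t =>
    s * U t - F (ln (1 / sqrt (t ^ 2 + y ^ 2))) <=
    s * U x - F (ln (1 / sqrt (x ^ 2 + y ^ 2)))) ->
  s * Derive_n U 2 x <=
    F'' (ln (1 / sqrt (x ^ 2 + y ^ 2))) * (x ^ 2 / (x ^ 2 + y ^ 2) ^ 2) +
    F' (ln (1 / sqrt (x ^ 2 + y ^ 2))) *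
      ((x ^ 2 - y ^ 2) / (x ^ 2 + y ^ 2) ^ 2).
Proof.
  intros HF HF' Hr HU HU' Hmax.
  set (phi := fun t => ln (1 / sqrt (t ^ 2 + y ^ 2))) in *.
  change (ln (1 / sqrt (x ^ 2 + y ^ 2))) with (phi x) in *.
  assert (Hphi_pos : forall t, 0 < t ^ 2 + y ^ 2 < 1 -> 0 < phi t).
  { intros t Ht. apply log_modulus_pos. split.
    - now apply sqrt_lt_R0.
    - rewrite <- sqrt_1. now apply sqrt_lt_1_alt; lra. }
  assert (Hnear : locally x (fun t => 0 < t ^ 2 + y ^ 2 < 1)).
  { assert (Hc : continuous (fun t => t ^ 2 + y ^ 2) x).
    { apply (ex_derive_continuous (fun t => t ^ 2 + y ^ 2)). now auto_derive. }
    apply (Hc (fun v => 0 < v < 1)), (open_and (fun v => 0 < v) (fun v => v < 1)).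
    - apply open_gt.
    - apply open_lt.
    - exact Hr. }
  apply Rminus_le.
  apply (second_derivative_nonpos_at_local_max
    (fun t => s * U t - F (phi t))
    (fun t => s * Derive U t - (- t / (t ^ 2 + y ^ 2)) * F' (phi t)) x).
  - generalize (filter_and _ _ HU Hnear). apply filter_imp.
    intros t [Ht1 Ht2].
    apply (is_derive_minus (fun t => s * U t) (fun t => F (phi t))).
    + apply (is_derive_scal U). now apply Derive_correct.
    + apply (is_derive_comp F phi); [now apply HF, Hphi_pos|].
      now apply is_derive_log_modulus.
  - replace (s * Derive_n U 2 x - _) with
      (s * Derive (Derive U) x -
       ((x ^ 2 - y ^ 2) / (x ^ 2 + y ^ 2) ^ 2 * F' (phi x) +
        (- x / (x ^ 2 + y ^ 2)) * ((- x / (x ^ 2 + y ^ 2)) * F'' (phi x))))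
      by (change (Derive_n U 2 x) with (Derive (Derive U) x); field; lra).
    apply (is_derive_minus (fun t => s * Derive U t)
             (fun t => - t / (t ^ 2 + y ^ 2) * F' (phi t))).
    + apply (is_derive_scal (Derive U)). now apply Derive_correct.
    + apply (is_derive_mult (fun t => - t / (t ^ 2 + y ^ 2)) (fun t => F' (phi t))).
      * auto_derive; [lra|]. field. lra.
      * apply (is_derive_comp F' phi); [now apply HF', Hphi_pos|].
        now apply is_derive_log_modulus.
      * intros; apply Rmult_comm.
  - exact Hmax.
Qed.

Lemma locally_slice_fst (P : C -> Prop) (z : C) :
  locally z P -> locally (fst z) (fun t => P (t, snd z)).
Proof.
  intros [e He]. exists e. intros t Ht. apply He. split; [exact Ht|].
  apply ball_center.
Qed.

Lemma locally_slice_snd (P : C -> Prop) (z : C) :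
  locally z P -> locally (snd z) (fun t => P (fst z, t)).
Proof.
  intros [e He]. exists e. intros t Ht. apply He. split; [|exact Ht].
  apply ball_center.
Qed.

(** The right-hand side is the Laplacian of F(L), so this is the inequality
    Delta (s u - F(L)) <= 0 at a local maximum. *)
Lemma laplacian_le_radial (u : C -> R) (F F' F'' : R -> R) (s : R) (p : C) :
  (forall t, 0 < t -> is_derive F t (F' t)) ->
  (forall t, 0 < t -> is_derive F' t (F'' t)) ->
  C2_on punctured_disk u ->
  punctured_disk p ->
  locally p (fun z => s * u z - F (ln (1 / Cmod z)) <=
                      s * u p - F (ln (1 / Cmod p))) ->
  s * laplacian u p <= F'' (ln (1 / Cmod p)) / Cmod p ^ 2.
Proof.
  intros HF HF' Hu Hp Hmax.
  assert (Hnear : locally p punctured_disk).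
  { generalize (open_Cmod_between 0 1 p (proj1 (punctured_disk_Cmod p) Hp)).
    apply filter_imp. intros z; apply punctured_disk_Cmod. }
  assert (Hr : 0 < fst p ^ 2 + snd p ^ 2 < 1).
  { rewrite <- Cmod_sqr. apply punctured_disk_Cmod in Hp. split.
    - apply pow_lt; lra.
    - rewrite <- (pow1 2). apply pow_lt_compat_l || (simpl; nra). }
  assert (Hx := second_derivative_le_radial (fun t => u (t, snd p)) F F' F'' s
                  (fst p) (snd p) HF HF' Hr).
  assert (Hy := second_derivative_le_radial (fun t => u (fst p, t)) F F' F'' s
                  (snd p) (fst p) HF HF').
  rewrite (Rplus_comm (snd p ^ 2)) in Hy. specialize (Hy Hr).
  change (sqrt (fst p ^ 2 + snd p ^ 2)) with (Cmod p) in Hx, Hy.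
  destruct p as [x y]; simpl fst in *; simpl snd in *.
  assert (Hlap : laplacian u (x, y) =
    Derive_n (fun t => u (t, y)) 2 x + Derive_n (fun t => u (x, t)) 2 y) by easy.
  destruct (Hu _ Hp) as [_ [_ [_ [[_ [Hxx _]] [_ [_ [Hyy _]]]]]]].
  unfold in_xy in *; simpl fst in *; simpl snd in *.
  rewrite Hlap, Cmod_sqr; simpl fst; simpl snd.
  apply Rle_trans with
    (F'' (ln (1 / Cmod (x, y))) * (x ^ 2 / (x ^ 2 + y ^ 2) ^ 2) +
     F' (ln (1 / Cmod (x, y))) * ((x ^ 2 - y ^ 2) / (x ^ 2 + y ^ 2) ^ 2) +
     (F'' (ln (1 / Cmod (x, y))) * (y ^ 2 / (x ^ 2 + y ^ 2) ^ 2) +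
      F' (ln (1 / Cmod (x, y))) * ((y ^ 2 - x ^ 2) / (x ^ 2 + y ^ 2) ^ 2))).
  2: { right. field. lra. }
  rewrite Rmult_plus_distr_l. apply Rplus_le_compat.
  - apply Hx; [|exact Hxx|].
    + generalize (locally_slice_fst _ _ Hnear). apply filter_imp.
      intros t Ht. apply (Hu _ Ht).
    + exact (locally_slice_fst _ _ Hmax).
  - apply Hy; [|exact Hyy|].
    + generalize (locally_slice_snd _ _ Hnear). apply filter_imp.
      intros t Ht. apply (Hu _ Ht).
    + generalize (locally_slice_snd _ _ Hmax). apply filter_imp.
      intros t. simpl. rewrite (Rplus_comm (t * (t * 1))). easy.
Qed.

(** * Comparison with a barrier near the puncture *)

(** With the sign s included in v, the second hypothesis on v says that Delta v >= c / (|z|^2 L^2) where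
    v > eta, since L - ln L has Laplacian 1 / (|z|^2 L^2).  A barrier depending
    on the point z1 in question is used because it works for every c > 0, with
    no restriction that relates c to M. *)
Lemma le_near_0_of_laplacian_lower_bound
  (u : C -> R) (s k M c eta r0 : R) :
  let v z := s * (u z - (ln (1 / Cmod z) - ln (ln (1 / Cmod z))) + k) in
  C2_on punctured_disk u ->
  0 < M -> 0 < c -> 0 < eta -> 0 < r0 < 1 ->
  (forall z, 0 < Cmod z < r0 -> v z <= M) ->
  (forall z, 0 < Cmod z < r0 -> eta < v z ->
     (s + c) / (Cmod z ^ 2 * ln (1 / Cmod z) ^ 2) <= s * laplacian u z) ->
  locally' (RtoC 0) (fun z => v z <= eta).
Proof.
  intros v Hu HM Hc Heta Hr0 HvM Hlap.
  (* A lam^2 = M makes the barrier dominate v on the boundary of the annulus;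
     lam > max (1, 4 M / c) then gives 2 A (1 + lam) <= 4 M / lam < c. *)
  set (lam := 1 + 4 * M / c).
  assert (Hlam : 1 < lam).
  { unfold lam. assert (0 < 4 * M / c) by (apply Rdiv_lt_0_compat; lra). lra. }
  set (A := M / lam ^ 2).
  assert (HA : 0 < A) by (apply Rdiv_lt_0_compat; [lra | apply pow_lt; lra]).
  assert (HAM : A * lam ^ 2 = M) by (unfold A; field; lra).
  assert (HAc : 2 * A * (1 + lam) < c).
  { assert (Hcl : c * lam = c + 4 * M) by (unfold lam; field; lra).
    apply Rmult_lt_reg_r with (lam ^ 2); [apply pow_lt; lra|].
    replace (2 * A * (1 + lam) * lam ^ 2) with (2 * (A * lam ^ 2) * (1 + lam)) by ring.
    rewrite HAM. replace (c * lam ^ 2) with ((c * lam) * lam) by ring.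
    rewrite Hcl. nra. }
  assert (Hs0 := log_modulus_pos r0 Hr0).
  set (s0 := ln (1 / r0)) in *.
  (* For s1 > s0 exp lam the whole annulus lies in the region L > s0. *)
  apply (locally'_Cmod _ (exp (- (s0 * exp lam)))); [apply exp_pos|].
  intros z1 [Hz1 Hz1'].
  set (s1 := ln (1 / Cmod z1)).
  assert (Hs1 : s0 * exp lam < s1).
  { rewrite <- (log_modulus_exp (s0 * exp lam)). apply ln_increasing.
    - apply Rdiv_lt_0_compat; [lra | apply exp_pos].
    - apply Rmult_lt_compat_l; [lra|]. apply Rinv_lt_contravar; [|exact Hz1'].
      apply Rmult_lt_0_compat; [exact Hz1 | apply exp_pos]. }
  assert (Hel : 1 < exp lam) by (assert (H := exp_ineq1 lam ltac:(lra)); lra).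
  assert (Hs1s0 : s0 < s1) by nra.
  assert (Hlow : s0 < s1 * exp (- lam)).
  { rewrite exp_Ropp. apply Rmult_lt_reg_r with (exp lam); [lra|].
    rewrite Rmult_assoc, Rinv_l by lra. lra. }
  set (rho1 := exp (- (s1 * exp lam))). set (rho2 := exp (- (s1 * exp (- lam)))).
  assert (Hrho1 : 0 < rho1) by apply exp_pos.
  assert (Hrho2 : rho2 < r0).
  { rewrite <- (exp_opp_log_modulus r0) by lra. apply exp_increasing. fold s0. lra. }
  assert (Hexplog : forall z, 0 < Cmod z -> Cmod z = exp (- ln (1 / Cmod z))).
  { intros z Hz. now rewrite exp_opp_log_modulus. }
  set (K := fun z : C => rho1 <= Cmod z <= rho2).
  assert (HK : forall z, K z -> 0 < Cmod z < r0) by (unfold K; intros; lra).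
  assert (HKd : forall z, K z -> punctured_disk z).
  { intros z Kz. apply punctured_disk_Cmod. specialize (HK z Kz). lra. }
  assert (Kz1 : K z1).
  { unfold K. rewrite (Hexplog z1 Hz1). fold s1. unfold rho1, rho2.
    assert (exp (- lam) < 1) by (rewrite <- exp_0; apply exp_increasing; lra).
    split; apply Rlt_le, exp_increasing; nra. }
  (* s u - F(L) is v minus the barrier. *)
  set (F := fun t => s * (t - ln t) - s * k + eta + A * (ln t - ln s1) ^ 2).
  set (F' := fun t => s * (1 - / t) + 2 * A * (ln t - ln s1) / t).
  set (F'' := fun t => (s + 2 * A * (1 - (ln t - ln s1))) / t ^ 2).
  assert (HF : forall t, 0 < t -> is_derive F t (F' t)).
  { intros t Ht. unfold F, F'. auto_derive; [easy|]. field. lra. }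
  assert (HF' : forall t, 0 < t -> is_derive F' t (F'' t)).
  { intros t Ht. unfold F', F''. auto_derive; [repeat split; lra|]. field. lra. }
  set (psi := fun z => s * u z - F (ln (1 / Cmod z))).
  assert (Hpsi : forall z, psi z =
    v z - eta - A * (ln (ln (1 / Cmod z)) - ln s1) ^ 2).
  { intros z. unfold psi, F, v. ring. }
  assert (Hpsi1 : psi z1 = v z1 - eta).
  { rewrite Hpsi. fold s1. ring. }
  destruct (continuous_attains_max K psi 1) as [p [Kp Hmax]].
  { apply closed_Cmod_between. }
  { intros z Kz. specialize (HK z Kz). assert (Hm := Rmax_Cmod z).
    assert (H1 := Rmax_l (Rabs (fst z)) (Rabs (snd z))).
    assert (H2 := Rmax_r (Rabs (fst z)) (Rabs (snd z))). lra. }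
  { intros z Kz. specialize (HKd z Kz).
    apply (continuous_minus (fun z => s * u z) (fun z => F (ln (1 / Cmod z)))).
    - apply (continuous_scal_r s u).
      destruct (Hu z HKd) as [Hc2 _].
      apply continuity_2d_pt_filterlim in Hc2. destruct z as [x y].
      revert Hc2. apply filterlim_ext. now intros [? ?].
    - apply (continuous_comp (fun z => ln (1 / Cmod z)) F).
      + now apply continuous_log_modulus.
      + apply (ex_derive_continuous F). eexists. apply HF, log_modulus_pos.
        now apply punctured_disk_Cmod. }
  { now exists z1. }
  apply Rnot_lt_le; intro Hgt.
  assert (Hp := Hmax z1 Kz1). rewrite Hpsi1 in Hp.
  assert (Hlog1 : ln (s1 * exp lam) - ln s1 = lam).
  { rewrite ln_mult, ln_exp; [ring | lra | lra]. }
  assert (Hlog2 : ln (s1 * exp (- lam)) - ln s1 = - lam).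
  { rewrite ln_mult, ln_exp; [ring | lra | apply exp_pos]. }
  assert (HvMp := HvM p (HK p Kp)).
  (* On both boundary circles v minus the barrier is at most M - eta - A lam^2 < 0. *)
  assert (Hpint : rho1 < Cmod p < rho2).
  { rewrite Hpsi in Hp. destruct Kp as [K1 K2]. split.
    - apply Rnot_le_lt; intro H. assert (E : Cmod p = rho1) by lra.
      rewrite E in Hp. unfold rho1 in Hp. rewrite log_modulus_exp, Hlog1 in Hp. lra.
    - apply Rnot_le_lt; intro H. assert (E : Cmod p = rho2) by lra.
      rewrite E in Hp. unfold rho2 in Hp. rewrite log_modulus_exp, Hlog2 in Hp.
      replace ((- lam) ^ 2) with (lam ^ 2) in Hp by ring. lra. }
  assert (Hpdisk := HKd p Kp).
  assert (Hpr := HK p Kp).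
  assert (HLp : 0 < ln (1 / Cmod p)) by (apply log_modulus_pos; lra).
  assert (Htest := laplacian_le_radial u F F' F'' s p HF HF' Hu Hpdisk).
  assert (Hloc : locally p (fun z => psi z <= psi p)).
  { generalize (open_Cmod_between rho1 rho2 p Hpint). apply filter_imp.
    intros z Hz. apply Hmax. unfold K; lra. }
  specialize (Htest Hloc).
  assert (Hvp : eta < v p).
  { rewrite Hpsi in Hp.
    assert (0 <= A * (ln (ln (1 / Cmod p)) - ln s1) ^ 2)
      by (apply Rmult_le_pos; [lra | apply pow2_ge_0]). lra. }
  assert (Hlow' := Hlap p Hpr Hvp).
  assert (Htau : - lam <= ln (ln (1 / Cmod p)) - ln s1).
  { rewrite <- Hlog2. apply Rplus_le_compat_r, ln_le.
    - lra.
    - rewrite <- (log_modulus_exp (s1 * exp (- lam))). apply log_modulus_le.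
      fold rho2. lra. }
  assert (Hchain := Rle_trans _ _ _ Hlow' Htest). unfold F'' in Hchain.
  set (L := ln (1 / Cmod p)) in *. set (tau := ln L - ln s1) in *.
  assert (HD : 0 < Cmod p ^ 2 * L ^ 2).
  { apply Rmult_lt_0_compat; apply pow_lt; lra. }
  apply (Rmult_le_compat_r (Cmod p ^ 2 * L ^ 2)) in Hchain; [|lra].
  replace ((s + c) / (Cmod p ^ 2 * L ^ 2) * (Cmod p ^ 2 * L ^ 2)) with (s + c)
    in Hchain by (field; lra).
  replace (_ / L ^ 2 / Cmod p ^ 2 * _) with (s + 2 * A * (1 - tau)) in Hchain
    by (field; lra).
  nra.
Qed.

(** * Both bounds for the curvature equation *)

Lemma signed_exp_increasing (s a b : R) :
  s = 1 \/ s = - 1 -> a < b -> s * exp (2 * s * a) < s * exp (2 * s * b).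
Proof.
  intros [-> | ->] Hab.
  - assert (H : exp (2 * 1 * a) < exp (2 * 1 * b)) by (apply exp_increasing; lra). lra.
  - assert (H : exp (2 * - 1 * b) < exp (2 * - 1 * a)) by (apply exp_increasing; lra). lra.
Qed.

(** Here exp (2 (- ln r - ln (ln (1/r)))) = 1 / (r^2 ln (1/r)^2) is the
    square of the density of the hyperbolic metric of the punctured disk. *)
Lemma exp_hyperbolic_density (r x : R) :
  0 < r < 1 ->
  exp (2 * (- ln r - ln (ln (1 / r)) + x)) =
  exp (2 * x) / (r ^ 2 * ln (1 / r) ^ 2).
Proof.
  intros Hr. assert (HL := log_modulus_pos r Hr).
  assert (Hsq : forall y, exp (2 * y) = exp y ^ 2).
  { intros y. replace (2 * y) with (y + y) by ring. rewrite exp_plus. ring. }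
  unfold Rminus. rewrite !Hsq, !exp_plus, !exp_Ropp, !exp_ln by lra. field. lra.
Qed.

(** For s = 1 the forcing term is bounded below because exp (2 (w + k)) > 1 by a
    fixed amount where w + k > eta; for s = - 1 because exp (2 (w + k)) < 1 by a
    fixed amount where w + k < - eta.  Writing the exponent as 2 s (s (w + k))
    treats both at once. *)
Lemma curvature_solution_one_sided_bound (kappa u w : C -> R) (s : R)
  (kappa_cont : forall z : C, unit_disk z -> continuous kappa z)
  (kappa0_neg : kappa (RtoC 0) < 0)
  (u_def : forall z : C, punctured_disk z ->
     u z = - ln (Cmod z) - ln (ln (1 / Cmod z)) + w z)
  (w_bounded : bigO_1_at_0 w)
  (u_C2 : C2_on punctured_disk u)
  (u_sol : forall z : C, punctured_disk z ->
     laplacian u z = - kappa z * exp (2 * u z))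
  (eta : R) :
  s = 1 \/ s = - 1 -> 0 < eta ->
  locally' (RtoC 0)
    (fun z => s * (w z + ln (sqrt (- kappa (RtoC 0)))) <= eta).
Proof.
  intros Hs Heta.
  set (a := - kappa (RtoC 0)). assert (Ha : 0 < a) by (unfold a; lra).
  set (k := ln (sqrt a)).
  assert (Hk : exp (2 * k) = a).
  { replace (2 * k) with (k + k) by ring.
    unfold k. rewrite exp_plus, exp_ln by now apply sqrt_lt_R0.
    apply sqrt_sqrt; lra. }
  (* Half of the gap left by the limit - kappa(z) -> a, so that a strict
     inequality survives near 0. *)
  set (c := (s * exp (2 * s * eta) - s) / 2).
  assert (Hc : 0 < c).
  { assert (H := signed_exp_increasing s 0 eta Hs Heta).
    rewrite Rmult_0_r, exp_0 in H. unfold c; lra. }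
  destruct w_bounded as [B HB].
  assert (Hkappa : locally' (RtoC 0) (fun z =>
    0 < - kappa z /\ (s + c) * a < - kappa z * (s * exp (2 * s * eta)))).
  { assert (Hcont : continuous kappa (RtoC 0)).
    { apply kappa_cont. unfold unit_disk. rewrite Cmod_0. lra. }
    apply (filter_le_within (fun z => z <> RtoC 0)).
    apply (Hcont (fun x => 0 < - x /\ (s + c) * a < - x * (s * exp (2 * s * eta)))).
    apply (open_and (fun x => 0 < - x)
      (fun x => (s + c) * a < - x * (s * exp (2 * s * eta)))).
    - apply (open_comp (fun x => - x) (fun y => 0 < y)); [|apply open_gt].
      intros x _. apply (ex_derive_continuous (fun x => - x)). now auto_derive.
    - apply (open_comp (fun x => - x * (s * exp (2 * s * eta)))
        (fun y => (s + c) * a < y)); [|apply open_gt].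
      intros x _. apply (ex_derive_continuous (fun x => - x * (s * exp (2 * s * eta)))).
      now auto_derive.
    - fold a. split; [exact Ha|]. rewrite Rmult_comm.
      apply Rmult_lt_compat_l; [exact Ha|]. unfold c in *; lra. }
  destruct (locally'_Cmod_inv _ HB) as [r1 [Hr1 HB']].
  destruct (locally'_Cmod_inv _ Hkappa) as [r2 [Hr2 Hkappa']].
  set (r0 := Rmin r1 r2).
  assert (Hr0 : 0 < r0 < 1 /\ r0 <= r1 /\ r0 <= r2).
  { assert (H1 := Rmin_l r1 r2). assert (H2 := Rmin_r r1 r2).
    assert (H3 : 0 < Rmin r1 r2) by (apply Rmin_pos; lra). unfold r0; lra. }
  assert (Hv : forall z, 0 < Cmod z < r0 ->
    s * (u z - (ln (1 / Cmod z) - ln (ln (1 / Cmod z))) + k) = s * (w z + k)).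
  { intros z Hz. rewrite u_def by (apply punctured_disk_Cmod; lra).
    unfold Rdiv at 1 2 3. rewrite Rmult_1_l, ln_Rinv by lra. ring. }
  assert (Hmain : locally' (RtoC 0) (fun z =>
    s * (u z - (ln (1 / Cmod z) - ln (ln (1 / Cmod z))) + k) <= eta)).
  { apply (le_near_0_of_laplacian_lower_bound u s k (Rabs B + Rabs k + 1) c eta r0).
    - exact u_C2.
    - assert (H1 := Rabs_pos B). assert (H2 := Rabs_pos k). lra.
    - exact Hc.
    - exact Heta.
    - lra.
    - intros z Hz. rewrite Hv by exact Hz.
      assert (Hw : Rabs (w z) <= B) by (apply HB'; lra).
      assert (H1 := Rle_abs B). apply Rabs_le_between in Hw.
      assert (H2 := Rle_abs k). assert (H3 := Rle_abs (- k)). rewrite Rabs_Ropp in H3.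
      destruct Hs as [-> | ->]; lra.
    - intros z Hz. rewrite Hv by exact Hz. intros Hvz.
      assert (Hzd : punctured_disk z) by (apply punctured_disk_Cmod; lra).
      destruct (Hkappa' z) as [Hkz1 Hkz2]; [lra|].
      rewrite u_sol, (u_def z Hzd), exp_hyperbolic_density by (assumption || lra).
      assert (HL : 0 < ln (1 / Cmod z)) by (apply log_modulus_pos; lra).
      assert (HD : 0 < Cmod z ^ 2 * ln (1 / Cmod z) ^ 2).
      { apply Rmult_lt_0_compat; apply pow_lt; lra. }
      assert (Hexp := signed_exp_increasing s _ _ Hs Hvz).
      replace (2 * s * (s * (w z + k))) with (2 * w z + 2 * k) in Hexp
        by (destruct Hs as [-> | ->]; ring).
      rewrite exp_plus, Hk in Hexp.
      apply (Rmult_lt_compat_l (- kappa z)) in Hexp; [|exact Hkz1].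
      replace (s * (- kappa z * (exp (2 * w z) / (Cmod z ^ 2 * ln (1 / Cmod z) ^ 2))))
        with ((s * (- kappa z * exp (2 * w z))) / (Cmod z ^ 2 * ln (1 / Cmod z) ^ 2))
        by (field; lra).
      apply Rmult_le_compat_r; [now apply Rlt_le, Rinv_0_lt_compat|].
      apply Rmult_le_reg_r with a; [exact Ha|]. lra. }
  destruct (locally'_Cmod_inv _ Hmain) as [r3 [Hr3 Hmain']].
  apply (locally'_Cmod _ (Rmin r0 r3)); [apply Rmin_pos; lra|].
  intros z Hz. assert (H1 := Rmin_l r0 r3). assert (H2 := Rmin_r r0 r3).
  rewrite <- Hv by lra. apply Hmain'; lra.
Qed.

Theorem theorem3p4 (kappa u w : C -> R)
  (kappa_cont : forall z : C, unit_disk z -> continuous kappa z)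
  (kappa0_neg : kappa (RtoC 0) < 0)
  (u_def : forall z : C, punctured_disk z ->
     u z = - ln (Cmod z) - ln (ln (1 / Cmod z)) + w z)
  (w_bounded : bigO_1_at_0 w)
  (u_C2 : C2_on punctured_disk u)
  (u_sol : forall z : C, punctured_disk z ->
     laplacian u z = - kappa z * exp (2 * u z)) :
  continuous_at_0_with_value w (- ln (sqrt (- kappa (RtoC 0)))).
Proof.
  intros P [e HP]. assert (E := cond_pos e).
  assert (Hup := curvature_solution_one_sided_bound kappa u w 1 kappa_cont
    kappa0_neg u_def w_bounded u_C2 u_sol (e / 2) ltac:(lra) ltac:(lra)).
  assert (Hlow := curvature_solution_one_sided_bound kappa u w (- 1) kappa_cont
    kappa0_neg u_def w_bounded u_C2 u_sol (e / 2) ltac:(lra) ltac:(lra)).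
  unfold filtermap. generalize (filter_and _ _ Hup Hlow).
  apply filter_imp. intros z [H1 H2].
  apply HP. apply Rabs_lt_between.
  unfold minus, plus, opp; simpl. lra.
Qed.
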